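(* Let $\mathcal{G}$ be the eight graph (two loops of length $2\pi$ attached at one vertex), with Hamiltonian $H_0=-\partial_x^2$ and Neumann--Kirchhoff condition at the vertex. Then: (1) For every integers $k,l\ge0$, $k\ne l$, there exist an eigenfunction corresponding to $k^2$ and an eigenfunction corresponding to $l^2$ that share the same modulus. (2) For every integer $k\ge1$, there exist two $\mathbb{C}$-linearly independent eigenfunctions corresponding to $k^2$ that share the same modulus. (3) For every integers $k,l\ge0$, $k\ne l$, two eigenfunctions corresponding to $\left(\frac{2k+1}{2}\right)^2$ and $\left(\frac{2l+1}{2}\right)^2$ do not share the same modulus. (4) For every integers $k\ge0$, $l\ge1$, two eigenfunctions corresponding to $\left(\frac{2k+1}{2}\right)^2$ and $l^2$ do not share the same modulus.
   Context: The eight graph $\mathcal{G}$ has two edges, each parameterized by $[0,2\pi]$, and a single vertex with which all four extremities are identified. Functions on $\mathcal{G}$ are pairs $f=(f^1,f^2)$ of complex-valued functions on $[0,2\pi]$, and $L^2(\mathcal{G})=L^2(0,2\pi)\oplus L^2(0,2\pi)$. The domain of $H_0=-\partial_x^2$ is the set of $f$ with $f^j\in H^2(0,2\pi)$, $f^1(0)=f^1(2\pi)=f^2(0)=f^2(2\pi)$ and $\partial_xf^1(0)-\partial_xf^1(2\pi)+\partial_xf^2(0)-\partial_xf^2(2\pi)=0$. Two $\mathbb{C}$-linearly independent eigenfunctions share the same modulus if their moduli coincide at every point of $\mathcal{G}$. *)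

(* Defs.v *)
From HB Require Import structures.
From mathcomp Require Import all_boot all_order all_algebra.
From mathcomp Require Import all_classical all_reals all_analysis.
From mathcomp Require Import complex.

Set Implicit Arguments.
Unset Strict Implicit.
Unset Printing Implicit Defensive.

Import Order.TTheory GRing.Theory Num.Theory.
Import numFieldNormedType.Exports.

Local Open Scope classical_set_scope.
Local Open Scope ring_scope.

(* Functions on [0, 2pi] are represented by total functions on R; every
   notion below only depends on their values on this interval. *)
Definition edge (R : realType) : set R := `[0, 2 * pi].
Arguments edge R : clear implicits.

Definition edge_L2 (R : realType) (u : R -> R[i]) : Prop :=
  (((@complex.Re R \o u) \_ (edge R)) \in Lfun lebesgue_measure 2%:E) /\
  (((@complex.Im R \o u) \_ (edge R)) \in Lfun lebesgue_measure 2%:E).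

Definition edge_continuous (R : realType) (u : R -> R[i]) : Prop :=
  {within edge R, continuous (@complex.Re R \o u)} /\
  {within edge R, continuous (@complex.Im R \o u)}.

Definition edge_integral (R : realType) (u : R -> R[i]) : R[i] :=
  ((\int[lebesgue_measure]_(x in edge R) complex.Re (u x))
   +i* (\int[lebesgue_measure]_(x in edge R) complex.Im (u x)))%C.

(* Functions of class C^1 with compact support in the open interval
   (0, 2pi), extended by zero to R.  By linearity real-valued test functions
   suffice to define weak derivatives of complex-valued functions. *)
Definition edge_test (R : realType) (phi : R -> R) : Prop :=
  [/\ forall x, derivable phi x 1,
      continuous (derive1 phi) &
      exists a b, [/\ 0 < a, b < 2 * pi &
        forall x, ~ (a <= x <= b) -> phi x = 0]].

Definition weak_derivative (R : realType) (u v : R -> R[i]) : Prop :=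
  forall phi : R -> R, edge_test phi ->
    edge_integral (fun x => u x * (derive1 phi x : R)%:C%C) =
    - edge_integral (fun x => v x * (phi x)%:C%C).

(* u is (a representative of) an element of the Sobolev space H^1(0, 2pi)
   whose weak derivative is (represented by) v. *)
Definition edge_H1 (R : realType) (u v : R -> R[i]) : Prop :=
  [/\ edge_L2 u, edge_L2 v & weak_derivative u v].

(* u is an element of H^2(0, 2pi), with u' = v and u'' = w almost everywhere.
   Elements of H^2(0, 2pi) and their first derivatives have unique continuous
   representatives on [0, 2pi]; u and v are required to be these, so that
   their values at the end points are the boundary values. *)
Definition edge_H2 (R : realType) (u v w : R -> R[i]) : Prop :=
  [/\ edge_continuous u, edge_continuous v, edge_H1 u v & edge_H1 v w].

Definition eight_fun (R : realType) : Type :=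
  ((R -> R[i]) * (R -> R[i]))%type.

Definition vertex_continuous (R : realType) (f : eight_fun R) : Prop :=
  [/\ f.1 0 = f.1 (2 * pi), f.1 (2 * pi) = f.2 0 & f.2 0 = f.2 (2 * pi)].

Definition kirchhoff (R : realType) (df : eight_fun R) : Prop :=
  df.1 0 - df.1 (2 * pi) + df.2 0 - df.2 (2 * pi) = 0.

(* The graph of the operator H_0 = - d^2/dx^2: f is in the domain of H_0 and
   H_0 f = g in L^2 (weak derivatives being determined up to null sets). *)
Definition H0_graph (R : realType) (f g : eight_fun R) : Prop :=
  exists df : eight_fun R,
    [/\ edge_H2 f.1 df.1 (fun x => - g.1 x),
        edge_H2 f.2 df.2 (fun x => - g.2 x),
        vertex_continuous f &
        kirchhoff df].

Definition eigenfunction (R : realType) (lambda : R) (f : eight_fun R) : Prop :=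
  (exists2 x, edge R x & f.1 x <> 0 \/ f.2 x <> 0) /\
  H0_graph f (fun x => lambda%:C%C * f.1 x, fun x => lambda%:C%C * f.2 x).

Definition lin_indep (R : realType) (f g : eight_fun R) : Prop :=
  forall a b : R[i],
    (forall x, edge R x ->
      a * f.1 x + b * g.1 x = 0 /\ a * f.2 x + b * g.2 x = 0) ->
    a = 0 /\ b = 0.

Definition same_modulus (R : realType) (f g : eight_fun R) : Prop :=
  forall x, edge R x -> `|f.1 x| = `|g.1 x| /\ `|f.2 x| = `|g.2 x|.

(* Main.v *)
Require Import Defs.
From HB Require Import structures.
From mathcomp Require Import all_boot all_order all_algebra.
From mathcomp Require Import all_classical all_reals all_analysis.
From mathcomp Require Import complex.
From mathcomp Require Import measurable_realfun ring lra.

Set Implicit Arguments.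
Unset Strict Implicit.
Unset Printing Implicit Defensive.

Import Order.TTheory GRing.Theory Num.Theory.
Import numFieldNormedType.Exports.

Local Open Scope classical_set_scope.
Local Open Scope ring_scope.

(** On each loop an eigenfunction for the eigenvalue m ^+ 2, m <> 0, is a
    combination A cos (m x) + B sin (m x), so that everything is decided by the
    values of cos (m x) and sin (m x) at x = 2 pi.

    If m is an integer, e^(imx) is 2 pi-periodic.  Taken on both loops it is an
    eigenfunction for m ^+ 2 with modulus constantly 1 ([wave_eigenfunction]).
    The pairs e^(ikx), e^(ilx) and e^(ikx), e^(-ikx) prove the two existence
    claims; their independence comes from a point where e^(i(n-m)x) = -1
    ([wave_lin_indep]).

    If m is half an odd integer, cos (m 2 pi) = -1: continuity at the vertex
    kills the cosines and the Kirchhoff condition makes the sines on the two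
    loops opposite.  The eigenspace is the line spanned by
    (sin (m x), - sin (m x)) ([antiperiodic_eigenfunction]).  Equal moduli have
    equal zeros, and this refutes the two remaining coincidences: for half
    integers m > n, sin (m x) vanishes at pi / m and sin (n x) does not; for an
    integer l, the zero of the half integer eigenfunction at the vertex reduces
    the other one to a sine on the loop, which vanishes at x = pi, where
    sin (m pi) = +1 or -1 ([half_integer_moduli_differ],
    [half_integer_integer_moduli_differ]).

    The analytic content is that weak solutions are classical.  Let u' = v and
    v' = - m ^+ 2 u weakly.  If they held classically,
    u cos (m x) - v sin (m x) / m and u sin (m x) + v cos (m x) / m would be
    constant.  Multiplying a test function by cos (m x) or sin (m x) gives
    another test function, hence these combinations have weak derivative 0, and
    the du Bois-Reymond lemma ([du_bois_reymond]) makes them constants.  Solving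
    for u and v gives [weak_oscillator]. *)

Section EightGraph.
Variable R : realType.
Notation mu := (@lebesgue_measure R).
Implicit Types (u v h g psi phi : R -> R) (a b c m n x y : R).

(** * Continuous functions on an edge *)

Lemma twopi_gt0 : 0 < 2 * pi :> R.
Proof. by rewrite mulr_gt0 // pi_gt0. Qed.

Lemma edge0 : edge R 0.
Proof. by rewrite /edge/= in_itv/= lexx ltW ?twopi_gt0. Qed.

Lemma edge_pi : edge R pi.
Proof. by rewrite /edge/= in_itv/=; have := pi_gt0 R; lra. Qed.

Lemma edge_2pi : edge R (2 * pi).
Proof. by rewrite /edge/= in_itv/= lexx ltW ?twopi_gt0. Qed.

Lemma edge_measurable : measurable (edge R).
Proof. exact: measurable_itv. Qed.

Lemma edge_integrable u :
  {within edge R, continuous u} -> mu.-integrable (edge R) (EFin \o u).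
Proof. by apply: continuous_compact_integrable; exact: segment_compact. Qed.

Lemma within_edgeW u : continuous u -> {within edge R, continuous u}.
Proof. exact: continuous_subspaceT. Qed.

Lemma within_edgeM u v : {within edge R, continuous u} ->
  {within edge R, continuous v} ->
  {within edge R, continuous (fun x => u x * v x)}.
Proof. by move=> cu cv x; apply: continuousM; [exact: cu|exact: cv]. Qed.

Lemma within_edgeD u v : {within edge R, continuous u} ->
  {within edge R, continuous v} ->
  {within edge R, continuous (fun x => u x + v x)}.
Proof. by move=> cu cv x; apply: continuousD; [exact: cu|exact: cv]. Qed.

Lemma RintegralD_edge u v : {within edge R, continuous u} ->
  {within edge R, continuous v} ->
  \int[mu]_(x in edge R) (u x + v x) =
  \int[mu]_(x in edge R) u x + \int[mu]_(x in edge R) v x.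
Proof.
by move=> cu cv; rewrite RintegralD//; [exact: edge_measurable| exact: edge_integrable..].
Qed.

Lemma RintegralZ_edge c u : {within edge R, continuous u} ->
  \int[mu]_(x in edge R) (c * u x) = c * \int[mu]_(x in edge R) u x.
Proof.
by move=> cu; rewrite RintegralZl//; [exact: edge_measurable| exact: edge_integrable].
Qed.

Lemma derive1_eq (F psi : R -> R) : (forall x, is_derive x 1 F (psi x)) -> derive1 F = psi.
Proof. by move=> dF; apply/funext => x; rewrite derive1E; apply: derive_val. Qed.

Lemma is_derive_continuous u v : (forall x, is_derive x 1 u (v x)) -> continuous u.
Proof.
move=> du x; apply: differentiable_continuous; apply/derivable1_diffP.
exact: (@ex_derive _ _ _ _ _ _ _ (du x)).
Qed.

(** * The du Bois-Reymond lemma *)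

(** This is the source of test functions: the integral from 0 to x of psi is
    zero to the left of the support of psi, and to the right of it because the
    total integral vanishes. *)
Lemma compact_antiderivative psi a b :
  0 < a -> b < 2 * pi -> continuous psi ->
  (forall x, ~ (a <= x <= b) -> psi x = 0) ->
  \int[mu]_(x in edge R) psi x = 0 ->
  exists F : R -> R, (forall x, is_derive x 1 F (psi x)) /\
     (forall x, ~ (a <= x <= b) -> F x = 0).
Proof.
move=> a0 b2 cpsi psi0 intpsi.
(* For negative x the domain of integration is empty, so that F is already the
   extension by zero. *)
pose F x := \int[mu]_(t in `[0, x]) psi t.
have F0 x : x < a -> F x = 0.
  move=> xa; rewrite /F; transitivity (\int[mu]_(t in `[0, x]) (0 : R)); last first.
    by rewrite Rintegral_cst ?mul0r.
  apply: eq_Rintegral.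
  move=> t; rewrite inE/= in_itv/= => /andP[_ tx]; apply: psi0.
  by case/andP => at_ _; move: (le_lt_trans (le_trans at_ tx) xa); rewrite ltxx.
have dF x : is_derive x 1 F (psi x).
  have [x0|x0] := ltP 0 x.
    have xu : x < x + 1 by rewrite ltrDl.
    have := @continuous_FTC1_closed R psi 0 x (x + 1) xu _ x0 (cpsi x).
    case.
      apply: continuous_compact_integrable; first exact: segment_compact.
      exact: continuous_subspaceT.
    move=> dFx FE; apply: DeriveDef; first exact: dFx.
    by rewrite -derive1E; exact: FE.
  have -> : psi x = 0.
    by apply: psi0 => /andP[ax _]; move: (le_lt_trans (le_trans ax x0) a0); rewrite ltxx.
  apply: (@near_eq_is_derive _ _ _ (fun=> 0)).
  near=> y; apply/esym/F0; near: y; apply: lt_nbhsl. exact: (le_lt_trans x0).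
exists F; split => // x xab.
have [/F0 //|ax] := ltP x a.
have bx : b < x by rewrite ltNge; apply/negP => xb; apply: xab; rewrite ax.
have F2 : F (2 * pi) = 0 by [].
have cF := is_derive_continuous dF.
have MV y z : b < y -> y <= z -> F y = F z.
  move=> by_ yz; apply/esym/eqP; rewrite -subr_eq0.
  have [|c /itvP cyz ->] := @MVT_segment R F psi y z yz (fun t _ => dF t).
    exact: continuous_subspaceT.
  rewrite psi0 ?mul0r // => /andP[_ cb].
  have yc : y <= c by rewrite cyz.
  by move: (lt_le_trans by_ (le_trans yc cb)); rewrite ltxx.
have [x2|x2] := leP x (2 * pi); first by rewrite (MV _ _ bx x2).
by rewrite -(MV _ _ b2 (ltW x2)).
Unshelve. all: by end_near. Qed.

(** An antiderivative of g with compact support is nondecreasing and vanishes at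
    both ends of the edge, hence on all of it, and so does its derivative g. *)
Lemma edge_ge0_eq0 g a b : 0 < a -> b < 2 * pi -> continuous g ->
  (forall x, ~ (a <= x <= b) -> g x = 0) -> (forall x, 0 <= g x) ->
  \int[mu]_(x in edge R) g x = 0 -> forall x, g x = 0.
Proof.
move=> a0 b2 cg g0 gge0 intg x.
have [G [dG G0]] := compact_antiderivative a0 b2 cg g0 intg.
have [/andP[ax xb]|/negP/g0//] := boolP (a <= x <= b).
have G'E := derive1_eq dG.
have GE y : y \in `]0, (2 * pi)[ -> 0 = G y.
  rewrite in_itv/= => /andP[/ltW y0 /ltW y2].
  have G00 : G 0 = 0 by apply: G0 => /andP[/(lt_le_trans a0)]; rewrite ltxx.
  have G20 : G (2 * pi) = 0.
    by apply: G0 => /andP[_ /le_lt_trans/(_ b2)]; rewrite ltxx.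
  have mono : {in `[0, (2 * pi)] &, {homo G : x y / x <= y}}.
    apply: ger0_derive1_le_cc => [z _|z _|].
    - exact: ex_derive.
    - by rewrite G'E.
    - exact/continuous_subspaceT/(is_derive_continuous dG).
  apply/eqP; rewrite eq_le -{1}G00 -{2}G20.
  by rewrite !mono// in_itv/= ?lexx ?y0 ?y2// ltW ?twopi_gt0.
have : is_derive x 1 G 0.
  apply: (@near_eq_is_derive _ _ _ (fun=> 0)).
  near=> y; apply: GE; near: y; apply: near_in_itvoo.
  by rewrite in_itv/= (lt_le_trans a0 ax) (le_lt_trans xb b2).
by move=> dG0; rewrite -(@derive_val _ _ _ _ _ _ _ (dG x)) (@derive_val _ _ _ _ _ _ _ dG0).
Unshelve. all: by end_near. Qed.

(** A weight that is positive exactly on the interval from a to b; mere continuity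
    suffices, since test functions are antiderivatives of weighted functions. *)
Definition bump a b x : R := Num.max 0 ((x - a) * (b - x)).

Lemma bump_ge0 a b x : 0 <= bump a b x.
Proof. by rewrite /bump le_max lexx. Qed.

Lemma bump_gt0 a b x : a < x < b -> 0 < bump a b x.
Proof. by move=> /andP[ax xb]; rewrite /bump lt_max mulr_gt0 ?orbT// subr_gt0. Qed.

Lemma bump_eq0 a b x : ~ (a <= x <= b) -> a < b -> bump a b x = 0.
Proof.
move=> /negP; rewrite negb_and -!ltNge => xab ab.
rewrite /bump max_l//; case/orP: xab => H.
  by rewrite mulr_le0_ge0// ?subr_le0 ?subr_ge0; lra.
by rewrite mulr_ge0_le0// ?subr_le0 ?subr_ge0; lra.
Qed.

Lemma bump_continuous a b : continuous (bump a b).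
Proof.
move=> x.
apply: (@continuous_max _ _ (fun=> 0) (fun x => (x - a) * (b - x))); first exact: cvg_cst.
by apply: cvgM; apply: cvgB => //; exact: cvg_cst.
Qed.

(** The weight vanishes near the ends of the edge, which removes any jump of h
    there: the product is continuous on the whole line. *)
Lemma continuous_mul_bump h a b : 0 < a -> a < b -> b < 2 * pi ->
  {within edge R, continuous h} -> continuous (fun x => h x * bump a b x).
Proof.
move=> a0 ab b2 /(continuous_within_itvP _ twopi_gt0)[ch _ _] x.
have [xin|xout] := boolP (x \in `]0, (2 * pi)[).
  by apply: cvgM; [exact: ch|exact: bump_continuous].
have zero y : ~ (a <= y <= b) -> h y * bump a b y = 0.
  by move=> yab; rewrite bump_eq0 ?mulr0.
rewrite /continuous_at zero; last first.
  move=> /andP[ax xb]; move/negP: xout; apply.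
  by rewrite in_itv/= (lt_le_trans a0 ax) (le_lt_trans xb b2).
apply: (@cvg_near_cst _ _ _ _ _ _).
move: xout; rewrite in_itv/= negb_and -!leNgt => /orP[x0|x2].
- near=> y; apply: zero; apply/negP; rewrite negb_and -!ltNge; apply/orP; left.
  by near: y; apply: lt_nbhsl; exact: (le_lt_trans x0).
- near=> y; apply: zero; apply/negP; rewrite negb_and -!ltNge; apply/orP; right.
  by near: y; apply: lt_nbhsr; exact: (lt_le_trans b2).
Unshelve. all: by end_near. Qed.

(** Let c be the mean of h for the weight [bump a b].  Then (h - c) * bump a b has
    integral zero, so it is the derivative of a test function; testing h, and
    then h - c, against it gives that the integral of (h - c) ^+ 2 * bump a b is
    zero, which forces h = c where the weight is positive. *)
Lemma du_bois_reymond_interior h a b : 0 < a -> a < b -> b < 2 * pi ->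
  {within edge R, continuous h} ->
  (forall phi, edge_test phi -> \int[mu]_(x in edge R) (h x * derive1 phi x) = 0) ->
  exists c, forall x, a < x < b -> h x = c.
Proof.
move=> a0 ab b2 ch hw.
pose I u := \int[mu]_(x in edge R) u x.
pose eta := bump a b.
have ceta : continuous eta := @bump_continuous a b.
have eta0 x : ~ (a <= x <= b) -> eta x = 0 by move=> /bump_eq0; exact.
have Ieta : I eta != 0.
  apply/negP => /eqP Ieta.
  have := edge_ge0_eq0 a0 b2 ceta eta0 (bump_ge0 a b) Ieta ((a + b) / 2).
  have : 0 < eta ((a + b) / 2) by apply: bump_gt0; apply/andP; split; lra.
  by move=> + e0; rewrite e0 ltxx.
pose c := I (fun x => h x * eta x) / I eta.
exists c; pose hc x := h x - c.
have chc : {within edge R, continuous hc}.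
  by apply: (within_edgeD (v := fun=> - c)) => //; apply: within_edgeW => x; exact: cvg_cst.
pose psi x := hc x * eta x.
have cpsi : continuous psi by exact: continuous_mul_bump.
have psi0 x : ~ (a <= x <= b) -> psi x = 0 by move=> /eta0; rewrite /psi => ->; rewrite mulr0.
have Ipsi : I psi = 0.
  rewrite (_ : psi = fun x => h x * eta x + (- c) * eta x); last first.
    by apply/funext => x; rewrite /psi /hc mulrBl mulNr.
  rewrite /I RintegralD_edge ?RintegralZ_edge; last 3 first.
  - exact: within_edgeW.
  - by apply: within_edgeM => //; exact: within_edgeW.
  - by apply: within_edgeM; apply: within_edgeW => // x; exact: cvg_cst.
  by rewrite -!/(I _) /c mulNr divfK// subrr.
have [F [dF F0]] := compact_antiderivative a0 b2 cpsi psi0 Ipsi.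
have F'E := derive1_eq dF.
have Ihpsi : I (fun x => h x * psi x) = 0.
  rewrite -F'E; apply: hw; split.
  - by move=> x; exact: ex_derive.
  - by rewrite F'E.
  - by exists a, b.
pose g x := hc x * psi x.
have cg : continuous g.
  rewrite (_ : g = fun x => (hc x * hc x) * eta x).
    by apply: continuous_mul_bump => //; exact: within_edgeM.
  by apply/funext => x; rewrite /g /psi mulrA.
have g0 x : ~ (a <= x <= b) -> g x = 0 by move=> /psi0; rewrite /g => ->; rewrite mulr0.
have gge0 x : 0 <= g x.
  by rewrite /g /psi mulrA mulr_ge0 ?bump_ge0// -expr2 sqr_ge0.
have Ig : I g = 0.
  rewrite (_ : g = fun x => h x * psi x + (- c) * psi x); last first.
    by apply/funext => x; rewrite /g /hc mulrBl mulNr.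
  rewrite /I RintegralD_edge ?RintegralZ_edge; last 3 first.
  - exact: within_edgeW.
  - by apply: within_edgeM => //; exact: within_edgeW.
  - by apply: within_edgeM; apply: within_edgeW => // x; exact: cvg_cst.
  by rewrite -!/(I _) Ihpsi Ipsi mulr0 addr0.
move=> x xab; have := edge_ge0_eq0 a0 b2 cg g0 gge0 Ig x.
rewrite /g /psi mulrA => /eqP; rewrite !mulf_eq0 orbb.
by rewrite (gt_eqF (bump_gt0 xab)) orbF subr_eq0 => /eqP.
Qed.

(** Every interior point lies together with pi in an interval compactly contained
    in the edge, so h equals h pi in the interior; continuity gives the ends. *)
Lemma du_bois_reymond h : {within edge R, continuous h} ->
  (forall phi, edge_test phi -> \int[mu]_(x in edge R) (h x * derive1 phi x) = 0) ->
  exists c, forall x, edge R x -> h x = c.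
Proof.
move=> ch hw; exists (h pi).
have pi0 := pi_gt0 R.
have inner x : x \in `]0, (2 * pi)[ -> h pi = h x.
  rewrite in_itv/= => /andP[x0 x2].
  pose a := Num.min x pi / 2; pose b := (Num.max x pi + 2 * pi) / 2.
  have [ax api a0] : [/\ a < x, a < pi & 0 < a].
    by rewrite /a; case: (ltP x pi) => ?; split; lra.
  have [xb pib b2] : [/\ x < b, pi < b & b < 2 * pi].
    by rewrite /b; case: (ltP x pi) => ?; split; lra.
  have [c hc] := du_bois_reymond_interior a0 (lt_trans ax xb) b2 ch hw.
  by rewrite !hc ?ax ?xb ?api ?pib.
have [_ h0 h2] := (continuous_within_itvP _ twopi_gt0).1 ch.
move=> x; rewrite /edge/= in_itv/= => /andP[x0 x2].
have [x00|xn0] := eqVneq x 0.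
  rewrite x00; apply: (cvg_unique _ h0); first exact: norm_hausdorff.
  apply: cvg_near_cst; near=> y; apply/esym/inner; rewrite in_itv/=; apply/andP; split.
    by near: y; exact: nbhs_right_gt.
  by near: y; apply: nbhs_right_lt; exact: twopi_gt0.
have [x22|xn2] := eqVneq x (2 * pi).
  rewrite x22; apply: (cvg_unique _ h2); first exact: norm_hausdorff.
  apply: cvg_near_cst; near=> y; apply/esym/inner; rewrite in_itv/=; apply/andP; split.
    by near: y; apply: nbhs_left_gt; exact: twopi_gt0.
  by near: y; exact: nbhs_left_lt.
by apply/esym/inner; rewrite in_itv/= !lt_neqAle x0 x2 xn2 eq_sym xn0.
Unshelve. all: by end_near. Qed.

(** * The weak harmonic oscillator *)

Lemma is_derive_cosM m x : is_derive x 1 (fun y => cos (m * y)) (- (m * sin (m * x))).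
Proof. by apply: trigger_derive; rewrite /GRing.scale/=; ring. Qed.

Lemma is_derive_sinM m x : is_derive x 1 (fun y => sin (m * y)) (m * cos (m * x)).
Proof. by apply: trigger_derive; rewrite /GRing.scale/=; ring. Qed.

Lemma continuous_cosM m : continuous (fun x : R => cos (m * x)).
Proof. exact: (is_derive_continuous (is_derive_cosM m)). Qed.

Lemma continuous_sinM m : continuous (fun x : R => sin (m * x)).
Proof. exact: (is_derive_continuous (is_derive_sinM m)). Qed.

Lemma edge_test_continuous phi : edge_test phi -> continuous phi.
Proof.
move=> [dphi _ _] x; apply: differentiable_continuous; exact/derivable1_diffP.
Qed.

Lemma edge_test_derive1_continuous phi : edge_test phi -> continuous (derive1 phi).
Proof. by case. Qed.

(** Test functions are stable under multiplication by C^1 functions; this moves the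
    factors cos (m x) and sin (m x) from the solution to the test function. *)
Lemma edge_testM (w dw : R -> R) phi : (forall x, is_derive x 1 w (dw x)) -> continuous dw ->
  edge_test phi ->
  edge_test (fun x => w x * phi x) /\
  derive1 (fun x => w x * phi x) = fun x => w x * derive1 phi x + dw x * phi x.
Proof.
move=> dwE cdw phiT; have cphi := edge_test_continuous phiT.
have [dphi cdphi [a [b [a0 b2 phi0]]]] := phiT.
have dM x : is_derive x 1 (fun x => w x * phi x) (w x * derive1 phi x + dw x * phi x).
  have Hp : is_derive x 1 phi (derive1 phi x).
    by apply: DeriveDef; [exact: dphi|rewrite derive1E].
  have := @is_deriveM _ _ w phi x 1 (dw x) (derive1 phi x) (dwE x) Hp.
  by rewrite /GRing.scale/= [phi x * _]mulrC.
have E := derive1_eq dM; split; last exact: E.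
split.
- by move=> x; exact: (@ex_derive _ _ _ _ _ _ _ (dM x)).
- rewrite E => x; apply: cvgD; apply: cvgM; [|exact: cdphi|exact: cdw|exact: cphi].
  exact: (is_derive_continuous dwE).
- by exists a, b; split => // x /phi0 ->; rewrite mulr0.
Qed.

(** Variation of constants in weak form: the coefficients alpha and beta, solved
    for in terms of u and v, are candidates for constants, and the two weak
    equations, tested against cos (m x) phi and sin (m x) phi, say exactly that
    their weak derivatives vanish. *)
Lemma weak_oscillator u v m : m != 0 ->
  {within edge R, continuous u} -> {within edge R, continuous v} ->
  (forall phi, edge_test phi ->
    \int[mu]_(x in edge R) (u x * derive1 phi x) = - \int[mu]_(x in edge R) (v x * phi x)) ->
  (forall phi, edge_test phi ->
    \int[mu]_(x in edge R) (v x * derive1 phi x) =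
      - \int[mu]_(x in edge R) (- (m ^+ 2 * u x) * phi x)) ->
  exists al be, forall x, edge R x ->
    u x = al * cos (m * x) + be * sin (m * x) /\
    v x = m * (be * cos (m * x) - al * sin (m * x)).
Proof.
move=> m0 cu cv wu wv.
pose I f := \int[mu]_(x in edge R) f x.
pose A phi x := u x * derive1 phi x + v x * phi x.
pose B phi x := v x * derive1 phi x + (- (m ^+ 2 * u x)) * phi x.
have cmu : {within edge R, continuous (fun x => - (m ^+ 2 * u x))}.
  rewrite (_ : (fun _ => _) = fun x => (- m ^+ 2) * u x); last first.
    by apply/funext => x; rewrite mulNr.
  by apply: within_edgeM => //; apply: within_edgeW => x; exact: cvg_cst.
have cA phi : edge_test phi -> {within edge R, continuous (A phi)}.
  move=> pT; apply: within_edgeD; apply: within_edgeM => //; apply: within_edgeW.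
    exact: edge_test_derive1_continuous.
  exact: edge_test_continuous.
have cB phi : edge_test phi -> {within edge R, continuous (B phi)}.
  move=> pT; apply: within_edgeD; apply: within_edgeM => //; apply: within_edgeW.
    exact: edge_test_derive1_continuous.
  exact: edge_test_continuous.
have IA phi : edge_test phi -> I (A phi) = 0.
  move=> pT; rewrite /I RintegralD_edge.
  - by rewrite wu// addNr.
  - by apply: within_edgeM => //; apply: within_edgeW; exact: edge_test_derive1_continuous.
  - by apply: within_edgeM => //; apply: within_edgeW; exact: edge_test_continuous.
have IB phi : edge_test phi -> I (B phi) = 0.
  move=> pT; rewrite /I RintegralD_edge.
  - by rewrite wv// addNr.
  - by apply: within_edgeM => //; apply: within_edgeW; exact: edge_test_derive1_continuous.
  - by apply: within_edgeM => //; apply: within_edgeW; exact: edge_test_continuous.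
have comb (h : R -> R) phi1 phi2 t : edge_test phi1 -> edge_test phi2 ->
    (forall x, h x = A phi1 x + t * B phi2 x) -> I h = 0.
  move=> T1 T2 hE; rewrite (_ : h = fun x => A phi1 x + t * B phi2 x); last exact/funext.
  rewrite /I RintegralD_edge ?RintegralZ_edge.
  - by rewrite -!/(I _) IA// IB// mulr0 addr0.
  - exact: cB.
  - exact: cA.
  - by apply: within_edgeM; [apply: within_edgeW => x; exact: cvg_cst|exact: cB].
pose C x := cos (m * x); pose S x := sin (m * x).
have cC : continuous C := @continuous_cosM m.
have cS : continuous S := @continuous_sinM m.
have dC := @is_derive_cosM m.
have dS := @is_derive_sinM m.
have cdC : continuous (fun x => - (m * S x)).
  by move=> x; apply: cvgN; apply: cvgM; [exact: cvg_cst|exact: cS].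
have cdS : continuous (fun x => m * C x).
  by move=> x; apply: cvgM; [exact: cvg_cst|exact: cC].
have cst t : {within edge R, continuous (fun=> t : R)}.
  by apply: within_edgeW => x; exact: cvg_cst.
(* alpha = u cos (m x) - v sin (m x) / m *)
have [|phi pT|al pE] := @du_bois_reymond (fun x => u x * C x + (- m^-1) * (v x * S x)).
- apply: within_edgeD; apply: within_edgeM => //; first exact: within_edgeW.
  by apply: within_edgeM => //; exact: within_edgeW.
- have [T1 E1] := edge_testM dC cdC pT; have [T2 E2] := edge_testM dS cdS pT.
  apply: (comb _ _ _ (- m^-1) T1 T2) => x; rewrite /A /B E1 E2 /C /S.
  by field.
(* beta = u sin (m x) + v cos (m x) / m *)
have [|phi pT|be qE] := @du_bois_reymond (fun x => u x * S x + m^-1 * (v x * C x)).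
- apply: within_edgeD; apply: within_edgeM => //; first exact: within_edgeW.
  by apply: within_edgeM => //; exact: within_edgeW.
- have [T1 E1] := edge_testM dC cdC pT; have [T2 E2] := edge_testM dS cdS pT.
  apply: (comb _ _ _ m^-1 T2 T1) => x; rewrite /A /B E1 E2 /C /S.
  by field.
exists al, be => x xe; rewrite -(pE x xe) -(qE x xe) -/(C x) -/(S x).
have CS : C x ^+ 2 + S x ^+ 2 = 1 by exact: cos2Dsin2.
split.
- transitivity (u x * (C x ^+ 2 + S x ^+ 2)); first by rewrite CS mulr1.
  by ring.
- transitivity (v x * (C x ^+ 2 + S x ^+ 2)); first by rewrite CS mulr1.
  by field.
Qed.

(** * From complex to real functions *)

Lemma ReMr (z : R[i]) (r : R) : complex.Re (z * r%:C%C) = complex.Re z * r.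
Proof. by case: z => p q /=; rewrite mulr0 subr0. Qed.

Lemma ImMr (z : R[i]) (r : R) : complex.Im (z * r%:C%C) = complex.Im z * r.
Proof. by case: z => p q /=; rewrite mulr0 add0r. Qed.

Lemma ReNMl (z : R[i]) (r : R) : complex.Re (- (r%:C%C * z)) = - (r * complex.Re z).
Proof. by case: z => p q /=; rewrite mul0r subr0. Qed.

Lemma ImNMl (z : R[i]) (r : R) : complex.Im (- (r%:C%C * z)) = - (r * complex.Im z).
Proof. by case: z => p q /=; rewrite mul0r addr0. Qed.

Lemma weak_derivativeP (f g : R -> R[i]) :
  weak_derivative f g <->
  forall phi, edge_test phi ->
    \int[mu]_(x in edge R) (complex.Re (f x) * derive1 phi x) =
      - (\int[mu]_(x in edge R) (complex.Re (g x) * phi x)) /\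
    \int[mu]_(x in edge R) (complex.Im (f x) * derive1 phi x) =
      - \int[mu]_(x in edge R) (complex.Im (g x) * phi x).
Proof.
have ReE (k : R -> R[i]) w : \int[mu]_(x in edge R) complex.Re (k x * (w x)%:C%C) =
    \int[mu]_(x in edge R) (complex.Re (k x) * w x).
  by apply: eq_Rintegral => x _; exact: ReMr.
have ImE (k : R -> R[i]) w : \int[mu]_(x in edge R) complex.Im (k x * (w x)%:C%C) =
    \int[mu]_(x in edge R) (complex.Im (k x) * w x).
  by apply: eq_Rintegral => x _; exact: ImMr.
split=> [H phi /H|H phi /H[Hr Hi]].
  by rewrite /edge_integral => -[]; rewrite !ReE !ImE.
by rewrite /edge_integral !ReE !ImE Hr Hi.
Qed.

(** Real and imaginary parts solve the same real equation, since the eigenvalue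
    m ^+ 2 is real; their coefficients combine into complex ones. *)
Lemma edge_oscillator m (f df : R -> R[i]) : m != 0 ->
  edge_H2 f df (fun x => - ((m ^+ 2)%:C%C * f x)) ->
  exists A B : R[i], forall x, edge R x ->
    f x = A * (cos (m * x))%:C%C + B * (sin (m * x))%:C%C /\
    df x = m%:C%C * (B * (cos (m * x))%:C%C - A * (sin (m * x))%:C%C).
Proof.
move=> m0 [[cfr cfi] [cdr cdi] [_ _ /weak_derivativeP w1] [_ _ /weak_derivativeP w2]].
have [||al [be abE]] := weak_oscillator m0 cfr cdr.
- by move=> phi /w1[].
- move=> phi /w2[-> _]; congr (- _); apply: eq_Rintegral => x _.
  by rewrite ReNMl.
have [||al' [be' abE']] := weak_oscillator m0 cfi cdi.
- by move=> phi /w1[].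
- move=> phi /w2[_ ->]; congr (- _); apply: eq_Rintegral => x _.
  by rewrite ImNMl.
exists (al +i* al')%C, (be +i* be')%C => x xe.
have [/= fr dr] := abE x xe; have [/= fi di] := abE' x xe.
move: fr dr fi di; case: (f x) => ? ?; case: (df x) => ? ? /= -> -> -> ->.
by split; apply/eqP; rewrite eq_complex/=; apply/andP; split; apply/eqP; ring.
Qed.

Lemma edge_continuous_L2 (f : R -> R[i]) : edge_continuous f -> edge_L2 f.
Proof.
have L2 u : {within edge R, continuous u} -> u \_ (edge R) \in Lfun mu 2%:E.
  move=> cu.
  have mru : measurable_fun [set: measurableTypeR R] (u \_ (edge R)).
    apply: (@measurable_restrictT _ _ (measurableTypeR R) (measurableTypeR R)
      (edge R) u _).1; first exact: edge_measurable.
    by apply: subspace_continuous_measurable_fun => //; exact: edge_measurable.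
  apply/andP; split; rewrite inE/=; first exact: mru.
  rewrite /finite_norm unlock/=; apply: poweR_lty.
  have /(integrable_restrict mu edge_measurable measurableT _).1 :
     mu.-integrable (setT `&` edge R) (EFin \o (fun x => u x * u x)).
    by rewrite setTI; apply: edge_integrable; exact: within_edgeM.
  move=> /integrableP[_]; congr (_ < _)%E; apply: eq_integral => x _.
  rewrite !patchE; case: ifP => _ /=; last by rewrite !normr0 powR0.
  by rewrite powR_mulrn// expr2 normrM.
by move=> [cr ci]; split; exact: L2.
Qed.

Lemma edge_test_by_parts u v phi : (forall x, is_derive x 1 u (v x)) -> continuous v ->
  edge_test phi ->
  \int[mu]_(x in edge R) (u x * derive1 phi x) = - \int[mu]_(x in edge R) (v x * phi x).
Proof.
move=> du cv pT; have cphi := edge_test_continuous pT.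
have cu := is_derive_continuous du.
have [dphi cdphi [a [b [a0 b2 phi0]]]] := pT.
have LRu : derivable_oo_LRcontinuous u 0 (2 * pi).
  split; [|exact/cvg_at_right_filter/cu|exact/cvg_at_left_filter/cu].
  by move=> x _; exact: (@ex_derive _ _ _ _ _ _ _ (du x)).
have LRphi : derivable_oo_LRcontinuous phi 0 (2 * pi).
  split; [|exact/cvg_at_right_filter/cphi|exact/cvg_at_left_filter/cphi].
  by move=> x _; exact: dphi.
have u'E : {in `]0, (2 * pi)[, derive1 u =1 v} by move=> x _; rewrite (derive1_eq du).
have phi'E : {in `]0, (2 * pi)[, derive1 phi =1 derive1 phi} by [].
rewrite (Rintegration_by_parts twopi_gt0 (within_edgeW cv) LRu u'E
  (within_edgeW cdphi) LRphi phi'E).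
have phi00 : phi 0 = 0 by apply: phi0 => /andP[/(lt_le_trans a0)]; rewrite ltxx.
have phi20 : phi (2 * pi) = 0.
  by apply: phi0 => /andP[_ /le_lt_trans/(_ b2)]; rewrite ltxx.
by rewrite phi00 phi20 !mulr0 subrr sub0r.
Qed.

(** Integration by parts has no boundary term against a test function, so a
    classical derivative is a weak one. *)
Lemma classical_H1 (f g : R -> R[i]) :
  (forall x, is_derive x 1 (@complex.Re R \o f) (complex.Re (g x))) ->
  (forall x, is_derive x 1 (@complex.Im R \o f) (complex.Im (g x))) ->
  continuous (@complex.Re R \o g) -> continuous (@complex.Im R \o g) ->
  [/\ edge_continuous f, edge_continuous g & edge_H1 f g].
Proof.
move=> dr di cgr cgi.
have cf : edge_continuous f.
  by split; apply: within_edgeW; [exact: is_derive_continuous dr|exact: is_derive_continuous di].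
have cg : edge_continuous g by split; exact: within_edgeW.
split => //; split; [exact: edge_continuous_L2|exact: edge_continuous_L2|].
apply/weak_derivativeP => phi pT; split.
  exact: (@edge_test_by_parts _ _ phi dr).
exact: (@edge_test_by_parts _ _ phi di).
Qed.

(** * Plane waves for integer frequencies *)

Lemma cos_nat2pi (k : nat) : cos (k%:R * (2 * pi)) = 1 :> R.
Proof.
elim: k => [|k IH]; first by rewrite mul0r cos0.
by rewrite -natr1 mulrDl mul1r cosD IH [2 * pi]mulr_natl cos2pi sin2pi mulr1 mulr0 subr0.
Qed.

Lemma sin_natpi (l : nat) : sin (l%:R * pi) = 0 :> R.
Proof.
elim: l => [|l IH]; first by rewrite mul0r sin0.
by rewrite -natr1 mulrDl mul1r sinDpi IH oppr0.
Qed.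

Definition wave (n x : R) : R[i] := (cos (n * x) +i* sin (n * x))%C.
Definition dwave (n x : R) : R[i] := (- (n * sin (n * x)) +i* (n * cos (n * x)))%C.

Lemma continuous_scale n u : continuous u -> continuous (fun x => n * u x).
Proof. by move=> cu x; apply: cvgM; [exact: cvg_cst|exact: cu]. Qed.

Lemma continuous_opp u : continuous u -> continuous (fun x => - u x).
Proof. by move=> cu x; apply: cvgN; exact: cu. Qed.

Lemma wave_H2 n : edge_H2 (wave n) (dwave n) (fun x => - ((n ^+ 2)%:C%C * wave n x)).
Proof.
have [cw cdw H1] : [/\ edge_continuous (wave n), edge_continuous (dwave n) &
    edge_H1 (wave n) (dwave n)].
  apply: classical_H1.
  - exact: is_derive_cosM.
  - exact: is_derive_sinM.
  - exact/continuous_opp/continuous_scale/continuous_sinM.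
  - exact/continuous_scale/continuous_cosM.
have [_ _ H2] : [/\ edge_continuous (dwave n),
    edge_continuous (fun x => - ((n ^+ 2)%:C%C * wave n x)) &
    edge_H1 (dwave n) (fun x => - ((n ^+ 2)%:C%C * wave n x))].
  apply: classical_H1 => [x|x||].
  - rewrite ReNMl.
    have H := @is_derive_sinM n x.
    have := is_deriveN (is_deriveZ n H); rewrite /GRing.scale/= mulrA -expr2.
    exact.
  - rewrite ImNMl.
    have H := @is_derive_cosM n x.
    have := is_deriveZ n H; rewrite /GRing.scale/= mulrN mulrA -expr2.
    exact.
  - rewrite (_ : _ \o _ = fun x => - (n ^+ 2 * cos (n * x))); last first.
      by apply/funext => x /=; rewrite mul0r subr0.
    exact/continuous_opp/continuous_scale/continuous_cosM.
  - rewrite (_ : _ \o _ = fun x => - (n ^+ 2 * sin (n * x))); last first.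
      by apply/funext => x /=; rewrite mul0r addr0.
    exact/continuous_opp/continuous_scale/continuous_sinM.
by split.
Qed.

Lemma sin2pi_of_cos m : cos (m * (2 * pi)) ^+ 2 = 1 -> sin (m * (2 * pi)) = 0 :> R.
Proof.
move=> c1; have := cos2Dsin2 (m * (2 * pi)); rewrite c1 => /eqP.
by rewrite -subr_eq0 addrC addKr sqrf_eq0 => /eqP.
Qed.

Lemma wave0 n : wave n 0 = 1.
Proof. by rewrite /wave mulr0 cos0 sin0. Qed.

Lemma norm_wave n x : `|wave n x| = 1.
Proof. by rewrite normc_def /= cos2Dsin2 sqrtr1. Qed.

Lemma wave_eigenfunction n : cos (n * (2 * pi)) = 1 ->
  eigenfunction (n ^+ 2) (wave n, wave n).
Proof.
move=> c1.
have s0 : sin (n * (2 * pi)) = 0 by apply: sin2pi_of_cos; rewrite c1 expr1n.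
have w2 : wave n (2 * pi) = wave n 0 by rewrite wave0 /wave c1 s0.
split.
  exists 0; first exact: edge0.
  by left => /=; rewrite wave0; apply/eqP/oner_neq0.
exists (dwave n, dwave n); split; [exact: wave_H2|exact: wave_H2| |].
- by split; rewrite /= w2.
- rewrite /kirchhoff/= /dwave c1 s0 !mulr0 cos0 sin0 mulr0.
  by rewrite subrr add0r subrr.
Qed.

(** At x = 0 a vanishing combination must be a multiple of the difference of the
    two waves, which is not zero at the point pi / `|n - m| where their phases
    are opposite; the hypothesis puts that point on the edge. *)
Lemma wave_lin_indep n m : 1 <= `|n - m| -> lin_indep (wave n, wave n) (wave m, wave m).
Proof.
move=> nm1 a b H.
have nm0 : 0 < `|n - m| by exact: lt_le_trans nm1.
have := (H 0 edge0).1; rewrite /= !wave0 !mulr1 => /eqP; rewrite addr_eq0 => /eqP ab.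
suff b0 : b = 0 by rewrite ab b0 oppr0.
pose x := pi / `|n - m|.
have xe : edge R x.
  rewrite /edge/= in_itv/= divr_ge0 ?pi_ge0//=.
  by rewrite ler_pdivrMr//; have := pi_gt0 R; nra.
have [+ _] := H x xe; rewrite /= ab mulNr addrC -mulrBr => /eqP.
rewrite mulf_eq0 => /orP[/eqP//|]; rewrite subr_eq0 => /eqP[ce se].
have : cos (n * x - m * x) = 1.
  by rewrite cosB ce se -!expr2 cos2Dsin2.
have -> : cos (n * x - m * x) = -1.
  rewrite -mulrBl -cos_norm normrM [`|x|]ger0_norm; last first.
    by rewrite divr_ge0 ?pi_ge0.
  by rewrite mulrC divfK ?gt_eqF// cospi.
by move=> N11; exfalso; lra.
Qed.

Lemma wave_same_modulus n m : same_modulus (wave n, wave n) (wave m, wave m).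
Proof. by move=> x _ /=; rewrite !norm_wave. Qed.

Lemma nat_dist_ge1 (k l : nat) : k <> l -> 1 <= `|k%:R - l%:R| :> R.
Proof.
move=> /eqP; rewrite neq_ltn => /orP[] kl.
  rewrite distrC ger0_norm ?subr_ge0 ?ler_nat ?(ltnW kl)//.
  by rewrite lerBrDl natr1 ler_nat.
rewrite ger0_norm ?subr_ge0 ?ler_nat ?(ltnW kl)//.
by rewrite lerBrDl natr1 ler_nat.
Qed.

(** * Half-integer frequencies *)

(** The cosine coefficient A of an edge is its value at x = 0, and - A its value at
    2 pi; the vertex identifies both, so A = 0.  With A = 0 the derivative at
    2 pi is opposite to that at 0, and the Kirchhoff sum is 2 m (B1 + B2). *)
Lemma antiperiodic_eigenfunction m (f : eight_fun R) :
  m != 0 -> cos (m * (2 * pi)) = -1 -> eigenfunction (m ^+ 2) f ->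
  exists2 B : R[i], B != 0 & forall x, edge R x ->
    f.1 x = B * (sin (m * x))%:C%C /\ f.2 x = - B * (sin (m * x))%:C%C.
Proof.
move=> m0 c1 [fnz [df [H1 H2 [v1 v2 v3] K]]].
have s0 : sin (m * (2 * pi)) = 0 by apply: sin2pi_of_cos; rewrite c1 sqrrN expr1n.
have [A1 [B1 E1]] := edge_oscillator m0 H1.
have [A2 [B2 E2]] := edge_oscillator m0 H2.
have [f10 d10] := E1 _ edge0; have [f12 d12] := E1 _ edge_2pi.
have [f20 d20] := E2 _ edge0; have [f22 d22] := E2 _ edge_2pi.
move: f10 d10 f12 d12 f20 d20 f22 d22.
rewrite c1 s0 mulr0 cos0 sin0 rmorphN rmorph1 rmorph0 !mulr0 !mulr1 !addr0 !subr0 !mulrN1.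
move=> f10 d10 f12 d12 f20 d20 f22 d22.
have A10 : A1 = 0.
  by apply/eqP; rewrite -[_ == 0]eqNr -{1}f10 v1 f12 opprK.
have A20 : A2 = 0.
  by apply/eqP; rewrite -[_ == 0]eqNr -{1}f20 v3 f22 opprK.
have B12 : B2 = - B1.
  move: K; rewrite /kirchhoff d10 d12 d20 d22 => K.
  have {}K : (2 * m)%:C%C * (B1 + B2) = 0 by rewrite -K rmorphM/= rmorph_nat; ring.
  move/eqP: K; rewrite mulf_eq0 => /orP[|]; last by rewrite addrC addr_eq0 => /eqP.
  by rewrite (fmorph_eq0 (real_complex R)) mulf_eq0 (negbTE m0) pnatr_eq0.
have FE x : edge R x ->
    f.1 x = B1 * (sin (m * x))%:C%C /\ f.2 x = - B1 * (sin (m * x))%:C%C.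
  move=> xe; have [-> _] := E1 x xe; have [-> _] := E2 x xe.
  by rewrite A10 A20 B12 !mul0r !add0r.
exists B1 => //; apply/eqP => B10; have [x xe] := fnz.
by have [-> ->] := FE x xe; rewrite B10 oppr0 !mul0r => -[].
Qed.

Lemma scaled_sin_neq0 m (B : R[i]) x : B != 0 -> sin (m * x) != 0 -> B * (sin (m * x))%:C%C != 0.
Proof. by move=> B0 s0; rewrite mulf_neq0 ?(fmorph_eq0 (real_complex R)). Qed.

Definition half (k : nat) : R := (2 * k + 1)%:R / 2.

Lemma halfE k : half k = k%:R + 2^-1.
Proof. by rewrite /half natrD natrM; field. Qed.

Lemma half_gt0 k : 0 < half k.
Proof. by rewrite halfE; have := ler0n R k; lra. Qed.

Lemma cos_half k : cos (half k * (2 * pi)) = -1.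
Proof.
rewrite halfE mulrDl (_ : 2^-1 * (2 * pi) = pi); last by field.
by rewrite cosDpi cos_nat2pi.
Qed.

Lemma same_modulus_eq0 (f g : eight_fun R) x : same_modulus f g -> edge R x ->
  (f.1 x == 0) = (g.1 x == 0).
Proof. by move=> fg xe; rewrite -normr_eq0 (fg x xe).1 normr_eq0. Qed.

(** The first positive zero pi / half k of the faster sine lies on the edge, and
    the slower sine is still in its first positive arch there. *)
Lemma half_integer_moduli_differ (k l : nat) : (l < k)%N -> forall f g : eight_fun R,
  eigenfunction (half k ^+ 2) f -> eigenfunction (half l ^+ 2) g -> ~ same_modulus f g.
Proof.
move=> lk f g ef eg sm.
have [B B0 fE] := antiperiodic_eigenfunction (lt0r_neq0 (half_gt0 k)) (cos_half k) ef.
have [D D0 gE] := antiperiodic_eigenfunction (lt0r_neq0 (half_gt0 l)) (cos_half l) eg.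
have pi0 := pi_gt0 R.
have k1 : l%:R + 1 <= k%:R :> R by rewrite natr1 ler_nat.
have l0 := ler0n R l.
have hk := half_gt0 k; have hl := half_gt0 l.
pose x := pi / half k.
have xe : edge R x.
  rewrite /edge/= in_itv/=; apply/andP; split.
    by rewrite divr_ge0// ltW.
  by rewrite ler_pdivrMr// halfE; nra.
have kx : half k * x = pi by rewrite /x mulrC divfK// gt_eqF.
have := same_modulus_eq0 sm xe; rewrite (fE x xe).1 (gE x xe).1.
rewrite kx sinpi rmorph0 mulr0 eqxx => /esym.
apply/negP; apply: scaled_sin_neq0 => //; apply: lt0r_neq0; apply: sin_gt0_pi.
rewrite mulr_gt0 ?divr_gt0//= /x mulrCA gtr_pMr// ltr_pdivrMr// mul1r !halfE; lra.
Qed.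

Lemma same_modulus_sym (f g : eight_fun R) : same_modulus f g -> same_modulus g f.
Proof. by move=> sm x /sm[]. Qed.

(** Since f vanishes at the vertex, so does g, which leaves a multiple of
    sin (l x) on the first loop; this vanishes at x = pi, whereas
    cos (half k * 2 pi) = -1 excludes sin (half k * pi) = 0. *)
Lemma half_integer_integer_moduli_differ (k l : nat) : (1 <= l)%N ->
  forall f g : eight_fun R,
  eigenfunction (half k ^+ 2) f -> eigenfunction (l%:R ^+ 2) g ->
  ~ same_modulus f g.
Proof.
move=> l1 f g ef [_ [dg [G1 _ _ _]]] sm.
have [B B0 fE] := antiperiodic_eigenfunction (lt0r_neq0 (half_gt0 k)) (cos_half k) ef.
have l0 : l%:R != 0 :> R by rewrite pnatr_eq0 -lt0n.
have [A [D gE]] := edge_oscillator l0 G1.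
have A0 : A = 0.
  have := same_modulus_eq0 sm edge0.
  rewrite (fE _ edge0).1 (gE _ edge0).1 !mulr0 sin0 cos0 rmorph0 rmorph1.
  by rewrite !mulr0 mulr1 addr0 eqxx => /esym/eqP.
have := same_modulus_eq0 sm edge_pi.
rewrite (fE _ edge_pi).1 (gE _ edge_pi).1 A0 mul0r add0r sin_natpi rmorph0 mulr0 eqxx.
apply/negP; apply: scaled_sin_neq0 => //; apply/eqP => s0.
have := cos_half k; rewrite [2 * pi]mulr_natl mulrnAr cos_mulr2n.
have := cos2Dsin2 (half k * pi); rewrite s0 => H1 H2.
by rewrite expr0n/= addr0 in H1; rewrite H1 in H2; clear -H2; lra.
Qed.

End EightGraph.

Theorem proposition4p9 (R : realType) :
  [/\ (forall k l : nat, k <> l ->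
         exists f g : eight_fun R,
           [/\ eigenfunction (k%:R ^+ 2) f, eigenfunction (l%:R ^+ 2) g,
               lin_indep f g & same_modulus f g]),
      (forall k : nat, (1 <= k)%N ->
         exists f g : eight_fun R,
           [/\ eigenfunction (k%:R ^+ 2) f, eigenfunction (k%:R ^+ 2) g,
               lin_indep f g & same_modulus f g]),
      (forall k l : nat, k <> l ->
         forall f g : eight_fun R,
           eigenfunction (((2 * k + 1)%:R / 2) ^+ 2) f ->
           eigenfunction (((2 * l + 1)%:R / 2) ^+ 2) g ->
           ~ same_modulus f g) &
      (forall k l : nat, (1 <= l)%N ->
         forall f g : eight_fun R,
           eigenfunction (((2 * k + 1)%:R / 2) ^+ 2) f ->
           eigenfunction (l%:R ^+ 2) g ->
           ~ same_modulus f g)].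
Proof.
split=> [k l kl|k k1|k l /eqP|k l l1 f g].
- exists (wave k%:R, wave k%:R), (wave l%:R, wave l%:R); split.
  + exact/wave_eigenfunction/cos_nat2pi.
  + exact/wave_eigenfunction/cos_nat2pi.
  + exact/wave_lin_indep/nat_dist_ge1.
  + exact: wave_same_modulus.
- exists (wave k%:R, wave k%:R), (wave (- k%:R), wave (- k%:R)); split.
  + exact/wave_eigenfunction/cos_nat2pi.
  + by rewrite -sqrrN; apply: wave_eigenfunction; rewrite mulNr cosN cos_nat2pi.
  + apply: wave_lin_indep; rewrite opprK -natrD normr_nat ler1n.
    by rewrite addn_gt0 k1.
  + exact: wave_same_modulus.
- rewrite neq_ltn => /orP[kl|lk] f g ef eg sm.
    exact: (half_integer_moduli_differ kl eg ef (same_modulus_sym sm)).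
  exact: (half_integer_moduli_differ lk ef eg sm).
- exact: half_integer_integer_moduli_differ.
Qed.
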